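(* Let $H$ be a complex Hilbert space, let $T \in \mathcal{B}(H)$, let $\Omega$ be an open domain in the complex plane (with $\sigma(T)\subset\overline{\Omega}$) and let $K \ge 1$ be a real number. Denote $\tilde{K} = \frac{1}{2}\left( K + K^{-1}\right)$. The following assertions are equivalent: (1) $\Omega$ is a $K$-spectral set for $T$; (2) $\Omega$ is a $\tilde{K}$-numerical radius set for $T$.
   Context: $\mathcal{B}(H)$ is the algebra of bounded linear operators on the complex Hilbert space $H$, with operator norm $\|\cdot\|$, and $\sigma(T)$ is the spectrum of $T$. The numerical radius of $A\in\mathcal{B}(H)$ is $w(A)=\sup\{|\langle Ax,x\rangle| : \|x\|=1\}$. For a function $f$ on $\Omega$ put $\|f\|_\Omega=\sup\{|f(z)|: z\in\Omega\}$ (possibly $+\infty$). Let $T$ satisfy $\sigma(T)\subset\overline{\Omega}$, so that $f(T)$ is defined by the rational functional calculus for every rational function $f$ with poles off $\overline{\Omega}$. For a constant $c\ge 1$: - $\Omega$ is a $c$-spectral set for $T$ if $\|f(T)\|\le c\,\|f\|_\Omega$ for every rational function $f$ with poles off $\overline{\Omega}$; - $\Omega$ is a $c$-numerical radius set for $T$ if $w(f(T))\le c\,\|f\|_\Omega$ for every rational function $f$ with poles off $\overline{\Omega}$ (the inequality then extends to the uniform closure of these functions). *)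

(* Defs.v *)
From HB Require Import structures.
From mathcomp Require Import all_boot all_order all_algebra.
From mathcomp Require Import sesquilinear complex.
From mathcomp Require Import all_classical all_reals all_analysis.

Set Implicit Arguments.
Unset Strict Implicit.
Unset Printing Implicit Defensive.

Import Order.TTheory GRing.Theory Num.Theory.
Import numFieldNormedType.Exports.

Local Open Scope classical_set_scope.
Local Open Scope ring_scope.
Local Open Scope complex_scope.

(* The norm of a normed module over R[i] takes its values in R[i] (on the
   nonnegative real axis); this is the same number seen in R. *)
Definition rnorm (R : realType) (V : normedModType R[i]) (x : V) : R :=
  complex.Re `|x|.

Section Operators.
Variables (R : realType) (H : completeNormedModType R[i]).
Implicit Types (T S : H -> H) (p q : {poly R[i]}).

Definition bounded_operator T : Prop :=
  linear T /\ exists M : R, forall x, rnorm (T x) <= M * rnorm x.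

Definition operator_norm T : \bar R :=
  ereal_sup [set (rnorm (T x))%:E | x in [set x | rnorm x <= 1]].

Definition inverse_in_BH T : set (H -> H) :=
  [set S | [/\ bounded_operator S, cancel T S & cancel S T]].

Definition spectrum T : set R[i] :=
  [set z | ~ exists S, inverse_in_BH (fun x => z *: x - T x) S].

(* Equal to T^-1 when T is invertible in B(H), and to the junk value 0
   otherwise. *)
Definition operator_inv T : H -> H := xget (fun=> 0) (inverse_in_BH T).

Definition poly_calculus p T : H -> H :=
  fun x => \sum_(i < size p) p`_i *: iter i T x.

(* The value f(T) = p(T) q(T)^-1 of the rational function f = p / q at T. *)
Definition rational_calculus p q T : H -> H :=
  poly_calculus p T \o operator_inv (poly_calculus q T).

(* w(T). The supremum over the empty unit sphere of the zero space is -oo. *)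
Definition numerical_radius (dot : {dot H for Num.conj}) T : \bar R :=
  ereal_sup [set (complex.Re `|dot (T x) x|)%:E | x in [set x | rnorm x = 1]].

End Operators.

(* R[i]^o is R[i] with the topology of the modulus. For Omega nonempty this is
   the supremum of |f| over Omega, possibly +oo. *)
Definition norm_on (R : realType) (Omega : set R[i]^o) (f : R[i] -> R[i]) :
    \bar R :=
  ereal_sup [set (complex.Re `|f z|)%:E | z in Omega].

Definition rational_fun (R : realType) (p q : {poly R[i]}) : R[i] -> R[i] :=
  fun z => p.[z] / q.[z].

(* A rational function has all its poles off the closure of Omega iff it is a
   quotient p / q where q does not vanish there; p and q need not be coprime. *)
Definition no_zero_on_closure (R : realType) (Omega : set R[i]^o)
    (q : {poly R[i]}) : Prop :=
  forall z, closure Omega z -> q.[z] != 0.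

Definition spectral_set (R : realType) (H : completeNormedModType R[i])
    (c : R) (Omega : set R[i]^o) (T : H -> H) : Prop :=
  forall p q : {poly R[i]}, no_zero_on_closure Omega q ->
    (operator_norm (rational_calculus p q T)
       <= c%:E * norm_on Omega (rational_fun p q))%E.

Definition numerical_radius_set (R : realType) (H : completeNormedModType R[i])
    (dot : {dot H for Num.conj}) (c : R) (Omega : set R[i]^o) (T : H -> H) : Prop :=
  forall p q : {poly R[i]}, no_zero_on_closure Omega q ->
    (numerical_radius dot (rational_calculus p q T)
       <= c%:E * norm_on Omega (rational_fun p q))%E.

(* Main.v *)
(* Scale f so that |f| <= 1 on Omega, and let A = f(T).  For |a| < 1 the Moebius
   map phi_a(z) = (z - a) / (1 - conj(a) z) gives another rational function
   phi_a(f) bounded by 1 on Omega.  With y = A x, the bound |phi_a(A)| <= K reads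
   |y - a x| <= K |x - conj(a) y|, while w(phi_a(A)) <= (K + 1/K) / 2 reads
   |<y - a x, x - conj(a) y>| <= (K + 1/K) / 2 * |x - conj(a) y|^2.  Expanding the
   inner products, a single a with |a| = 1/K turns the first family of
   inequalities into |<y, x>| <= (K + 1/K) / 2 * |x|^2, and another one turns the
   second into |y| <= K |x|. *)

Require Import Defs.
From mathcomp Require Import all_boot all_order all_algebra.
From mathcomp Require Import sesquilinear complex.
From mathcomp Require Import all_classical all_reals all_analysis.
From mathcomp Require Import ring lra.

Set Implicit Arguments.
Unset Strict Implicit.
Unset Printing Implicit Defensive.

Import numFieldNormedType.Exports.

Local Open Scope classical_set_scope.
Local Open Scope complex_scope.
Local Open Scope ring_scope.

(** * Inner-product identities and the two Moebius inequalities for a pair of vectors *)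

Section HilbertNorm.
Import Order.TTheory GRing.Theory Num.Theory.
Variables (R : realType) (H : completeNormedModType R[i]).
Variables (dot : {dot H for Num.conj}).
Hypothesis norm_dot : forall x : H, `|x| ^+ 2 = dot x x.
Implicit Types (x y : H) (a u z : R[i]) (r K : R).

Lemma conjM z u : (z * u)^* = z^* * u^*.
Proof. exact: rmorphM. Qed.

Lemma conj_realC r : (r%:C)^* = r%:C.
Proof. exact: conjc_real. Qed.

Lemma Re_normE z : (complex.Re `|z|)%:C = `|z|.
Proof. by rewrite normc_def. Qed.

Lemma Re_norm_ge0 z : 0 <= complex.Re `|z|.
Proof. by rewrite -ler0c Re_normE. Qed.

Lemma realCM r1 r2 : r1%:C * r2%:C = (r1 * r2)%:C :> R[i].
Proof. exact/esym/(rmorphM (real_complex R)). Qed.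

Lemma Re_norm_realC r : 0 <= r -> complex.Re `|r%:C| = r.
Proof. by move=> r0; rewrite ger0_norm ?ler0c. Qed.

Lemma rnormE x : (rnorm x)%:C = `|x|.
Proof. by rewrite RRe_real ?ger0_real. Qed.

Lemma rnorm_ge0 x : 0 <= rnorm x.
Proof. by rewrite -ler0c rnormE. Qed.

Lemma rnorm_eq0 x : (rnorm x == 0) = (x == 0).
Proof. by rewrite -[RHS]normr_eq0 -rnormE (inj_eq (@complexI R)). Qed.

Lemma rnormZ a x : rnorm (a *: x) = complex.Re `|a| * rnorm x.
Proof. by apply: complexI; rewrite rmorphM /= Re_normE !rnormE normrZ. Qed.

Lemma dot_self x : dot x x = (rnorm x ^+ 2)%:C.
Proof. by rewrite -norm_dot rmorphXn /= rnormE. Qed.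

Lemma dotC x y : dot x y = (dot y x)^*.
Proof. by rewrite hermC expr0 mul1r. Qed.

Lemma dot_subZ (a b : R[i]) (x y x' y' : H) :
  dot (y - a *: x) (y' - b *: x') =
  dot y y' - b^* * dot y x' - a * (dot x y' - b^* * dot x x').
Proof. by rewrite linearBl linearZl_LR !linearBr !linearZr_LR. Qed.

Lemma dotZ a (b : R[i]) x y : dot (a *: x) (b *: y) = a * (b^* * dot x y).
Proof. by rewrite linearZl_LR linearZr_LR. Qed.

Lemma sqr_rnormB a x y :
  rnorm (y - a *: x) ^+ 2 =
  rnorm y ^+ 2 - 2 * complex.Re (a^* * dot y x)
    + complex.Re (a * a^*) * rnorm x ^+ 2.
Proof.
have -> : rnorm (y - a *: x) ^+ 2 =
    complex.Re (dot (y - a *: x) (y - a *: x)) by rewrite dot_self.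
rewrite dot_subZ (dotC x y) !dot_self.
move: (rnorm x ^+ 2) (rnorm y ^+ 2) => X Y.
by case: a => a b; case: (dot y x) => c d /=; ring.
Qed.

(** Writing a = r u with |u| = 1 separates the phase, which fixes the cross term, from the modulus
    r, which is tuned afterwards. *)
Lemma sqr_rnormB_unit u r x y : u * u^* = 1 ->
  rnorm (y - (r%:C * u) *: x) ^+ 2 =
  rnorm y ^+ 2 - 2 * r * complex.Re (u^* * dot y x) + r ^+ 2 * rnorm x ^+ 2.
Proof.
move=> u1; rewrite sqr_rnormB.
have -> : (r%:C * u) * (r%:C * u)^* = (r ^+ 2)%:C.
  rewrite conjM conj_realC mulrACA u1 mulr1.
  by apply/eqP; rewrite eq_complex /=; apply/andP; split; apply/eqP; ring.
move: (rnorm x ^+ 2) (rnorm y ^+ 2) => X Y.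
by case: u u1 => u1 u2 _; case: (dot y x) => c d /=; ring.
Qed.

(** The cross term is the same as for |y - a x|^2; only the weight r^2 moves from |x|^2 to |y|^2. *)
Lemma sqr_rnormB_unit_conj u r x y : u * u^* = 1 ->
  rnorm (x - (r%:C * u)^* *: y) ^+ 2 =
  rnorm x ^+ 2 - 2 * r * complex.Re (u^* * dot y x) + r ^+ 2 * rnorm y ^+ 2.
Proof.
move=> u1; have -> : (r%:C * u)^* = r%:C * u^*.
  by rewrite conjM conj_realC.
rewrite sqr_rnormB_unit; last by rewrite conjCK mulrC.
rewrite (dotC x); move: (rnorm x ^+ 2) (rnorm y ^+ 2) => X Y.
by case: u u1 => u1 u2 _; case: (dot y x) => c d /=; ring.
Qed.

Lemma norm_unit r u : 0 <= r -> u * u^* = 1 -> complex.Re `|r%:C * u| = r.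
Proof.
move=> r0 u1; have nu1 : `|u| = 1.
  by apply/eqP; rewrite -(@pexpr_eq1 _ _ 2) // normCK u1.
by rewrite normrM nu1 mulr1 ger0_norm ?ler0c.
Qed.

(** The witness is z/|z|, with the arbitrary value 1 at z = 0. *)
Lemma unit_phase z : {u : R[i] | u * u^* = 1 & u^* * z = `|z|}.
Proof.
have [->|z0] := eqVneq z 0.
  by exists 1; rewrite ?rmorph1 ?mulr1 // mulr0 normr0.
have nz0 : `|z| != 0 by rewrite normr_eq0.
have cn : `|z|^-1^* = `|z|^-1.
  by rewrite -Re_normE -fmorphV conj_realC.
exists (z * `|z|^-1); rewrite conjM cn.
  rewrite mulrACA -normCK -expr2 exprVn divff //.
  by rewrite expf_neq0.
rewrite mulrAC (mulrC _ z) -normCK expr2 mulfK //.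
Qed.

(* The extremal a has conj(a) <y, x> >= 0 and |a| = 1/K, since the |y|^2 terms
   then cancel. *)
Lemma moebius_norm_bound K x y : 1 <= K ->
  (forall a, complex.Re `|a| < 1 -> rnorm (y - a *: x) <= K * rnorm (x - a^* *: y)) ->
  complex.Re `|dot y x| <= 2^-1 * (K + K^-1) * rnorm x ^+ 2.
Proof.
move=> K1 yx; have K0 : 0 < K by exact: lt_le_trans K1.
have [u u1 um] := unit_phase (dot y x).
have sq r : 0 <= r < 1 ->
  rnorm y ^+ 2 - 2 * r * complex.Re `|dot y x| + r ^+ 2 * rnorm x ^+ 2 <=
  K ^+ 2 * (rnorm x ^+ 2 - 2 * r * complex.Re `|dot y x| + r ^+ 2 * rnorm y ^+ 2).
  move=> /andP[r0 r1]; rewrite -um -sqr_rnormB_unit // -sqr_rnormB_unit_conj //.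
  rewrite -exprMn lerXn2r ?nnegrE ?mulr_ge0 ?rnorm_ge0 ?(ltW K0) //.
  by apply: yx; rewrite norm_unit.
set m := complex.Re _ in sq *; set X := rnorm x ^+ 2 in sq *.
set Y := rnorm y ^+ 2 in sq *.
(* For K = 1 the choice |a| = 1/K is not allowed. Instead r = 0 gives Y <= X, and 0 <= |y - u x|^2
   gives 2 m <= X + Y <= 2 X. *)
have [K_eq|Kn1] := eqVneq K 1.
  have := sq 0; rewrite lexx ltr01 K_eq => /(_ isT) YX.
  have := sqr_ge0 (rnorm (y - (1%:C * u) *: x)).
  by rewrite sqr_rnormB_unit // um invr1 -/m -/X -/Y; nra.
have {Kn1 K1}K1 : 1 < K by rewrite lt_neqAle eq_sym Kn1.
have := sq K^-1; rewrite invr_ge0 (ltW K0) invf_lt1 // K1 => /(_ isT).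
have KV : K * K^-1 = 1 by rewrite divff ?gt_eqF.
set k := K^-1 in KV *.
have k0 : 0 < k by rewrite invr_gt0.
have -> : K ^+ 2 * (X - 2 * k * m + k ^+ 2 * Y) =
   K ^+ 2 * X - 2 * K * (K * k) * m + (K * k) ^+ 2 * Y by ring.
rewrite KV => ineq.
(* With Y cancelled, [ineq] says 2 (K - k) m <= (K^2 - k^2) X, to be divided by 2 (K - k) > 0. *)
have Kk : 0 < K - k by nra.
have -> : 2^-1 * (K + k) * X = (2 * (K - k))^-1 * ((K ^+ 2 - k ^+ 2) * X).
  by field; rewrite gt_eqF.
by rewrite mulrC ler_pdivlMr; nra.
Qed.

(* The extremal a has conj(a) <y, x> purely imaginary and |a| = 1/K, with |a|
   tending to 1 when K = 1. *)
Lemma moebius_numerical_bound K x y : 1 <= K ->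
  (forall a, complex.Re `|a| < 1 ->
     complex.Re `|dot (y - a *: x) (x - a^* *: y)| <=
     2^-1 * (K + K^-1) * rnorm (x - a^* *: y) ^+ 2) ->
  rnorm y <= K * rnorm x.
Proof.
move=> K1 yx; have K0 : 0 < K by exact: lt_le_trans K1.
(* Turning the phase of <y, x> by a quarter circle makes u^* <y, x> equal to -i |<y, x>|. *)
have [u [u1 um]] : exists u : R[i], u * u^* = 1 /\ complex.Re (u^* * dot y x) = 0.
  have [u u1 um] := unit_phase (dot y x); exists (u * 'i%C); split.
    rewrite conjM mulrACA u1 mul1r.
    by apply/eqP; rewrite eq_complex /=; apply/andP; split; apply/eqP; ring.
  by rewrite conjM mulrAC um -Re_normE /=; ring.
set X := rnorm x ^+ 2; set Y := rnorm y ^+ 2.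
have sq r : 0 <= r < 1 -> r * (X + Y) <= 2^-1 * (K + K^-1) * (X + r ^+ 2 * Y).
  move=> /andP[r0 r1].
  have -> : X + r ^+ 2 * Y = rnorm (x - (r%:C * u)^* *: y) ^+ 2.
    by rewrite sqr_rnormB_unit_conj // um mulr0 subr0.
  apply: le_trans (yx _ _); last by rewrite norm_unit.
  rewrite dot_subZ conjCK (dotC x y) !dot_self -/X -/Y.
  set w := (X in `|X|).
  (* Rotating w by u^* leaves its modulus unchanged and makes its real part -r (X + Y): the two
     remaining terms are purely imaginary. *)
  have <- : `|u^* * w| = `|w|.
    have nu1 : `|u^*| = 1.
      by apply/eqP; rewrite -(@pexpr_eq1 _ _ 2) // normCK conjCK mulrC u1.
    by rewrite normrM nu1 mul1r.
  have -> : r * (X + Y) = - complex.Re (u^* * w).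
    have -> : u^* * w = u^* * dot y x - (u * u^*) * (r * (X + Y))%:C
        + (r ^+ 2)%:C * (u * u^*) * (u^* * dot y x)^*.
      rewrite /w; case: (u) => a b; case: (dot y x) => c d.
      by apply/eqP; rewrite eq_complex /=; apply/andP; split; apply/eqP; ring.
    rewrite u1 mul1r mulr1; move: um; case: (u^* * dot y x) => c d /= ->; ring.
  by rewrite -lecR Re_normE; apply: le_trans (normc_ge_Re _); rewrite lecR -normrN ler_norm.
have X0 : 0 <= X by rewrite sqr_ge0.
have Y0 : 0 <= Y by rewrite sqr_ge0.
suff YX : Y <= K ^+ 2 * X.
  by rewrite -ler_sqr ?nnegrE ?mulr_ge0 ?rnorm_ge0 ?(ltW K0) // exprMn.
have [K_eq|Kn1] := eqVneq K 1.
  move: sq; rewrite K_eq invr1 expr1n mul1r => sq.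
  have rY r : 0 <= r < 1 -> r * Y <= X.
    by move=> r01; have := sq r r01; case/andP: r01 => r0 r1; nra.
  apply/ler_addgt0Pr => e e0.
  (* This ratio lies in [0, 1[, even when Y = 0, and tends to 1 with e when Y > 0; it yields Y^2 <=
     X (Y + e), hence Y <= X + e. *)
  have := rY (Y / (Y + e)).
  rewrite divr_ge0 ?addr_ge0 ?(ltW e0) //= ltr_pdivrMr; last lra.
  rewrite mul1r ltrDl e0 => /(_ isT); rewrite mulrAC ler_pdivrMr; last lra.
  by nra.
have {Kn1 K1}K1 : 1 < K by rewrite lt_neqAle eq_sym Kn1.
have := sq K^-1; rewrite invr_ge0 (ltW K0) invf_lt1 // K1 => /(_ isT).
have KV : K * K^-1 = 1 by rewrite divff ?gt_eqF.
set k := K^-1 in KV *.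
have k0 : 0 < k by rewrite invr_gt0.
have k1 : k < 1 by nra.
move=> ineq.
(* The factor 2 K^3 clears every denominator; what remains rearranges to (K^2 - 1) Y <= (K^2 - 1)
   K^2 X. *)
have : 2 * K ^+ 3 * (k * (X + Y)) <= 2 * K ^+ 3 * (2^-1 * (K + k) * (X + k ^+ 2 * Y)).
  by rewrite ler_wpM2l // mulr_ge0 // exprn_ge0 // ltW.
have -> : 2 * K ^+ 3 * (k * (X + Y)) = 2 * K ^+ 2 * (K * k) * (X + Y) by ring.
have -> : 2 * K ^+ 3 * (2^-1 * (K + k) * (X + k ^+ 2 * Y)) =
  (K ^+ 2 + K * k) * (K ^+ 2 * X + (K * k) ^+ 2 * Y) by field.
rewrite KV !expr1n mul1r mulr1 => {}ineq.
have K21 : 0 < K ^+ 2 - 1 by nra.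
by rewrite -subr_ge0 -(pmulr_rge0 _ K21); nra.
Qed.

End HilbertNorm.

(** * Polynomials in a linear operator and their invertibility *)

Section FunctionalCalculus.
Import Order.TTheory GRing.Theory Num.Theory.
Variables (R : realType) (H : completeNormedModType R[i]) (T : H -> H).
Hypothesis T_linear : linear T.
Implicit Types (x y : H) (c z : R[i]) (p q : {poly R[i]}) (S : H -> H).

(** Padding with zero coefficients lets polynomials of different sizes be summed over one index
    range. *)
Lemma poly_calculus_wide n p x : (size p <= n)%N ->
  poly_calculus p T x = \sum_(i < n) p`_i *: iter i T x.
Proof.
move=> pn; rewrite /poly_calculus (big_ord_widen _ (fun i => p`_i *: iter i T x) pn).
rewrite big_mkcond; apply: eq_bigr => i _.
by case: ltnP => // /(nth_default 0) ->; rewrite scale0r.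
Qed.

Lemma poly_calculusD p q x :
  poly_calculus (p + q) T x = poly_calculus p T x + poly_calculus q T x.
Proof.
rewrite !(@poly_calculus_wide (maxn (size p) (size q))) ?leq_maxl ?leq_maxr ?size_polyD //.
by rewrite -big_split; apply: eq_bigr => i _; rewrite coefD scalerDl.
Qed.

Lemma poly_calculusZ c p x :
  poly_calculus (c *: p) T x = c *: poly_calculus p T x.
Proof.
rewrite !(@poly_calculus_wide (size p)) ?size_scale_leq // scaler_sumr.
by apply: eq_bigr => i _; rewrite coefZ scalerA.
Qed.

Lemma poly_calculusB p q x :
  poly_calculus (p - q) T x = poly_calculus p T x - poly_calculus q T x.
Proof. by rewrite -scaleN1r poly_calculusD poly_calculusZ scaleN1r. Qed.

Lemma poly_calculusC c x : poly_calculus c%:P T x = c *: x.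
Proof. by rewrite (@poly_calculus_wide 1) ?size_polyC_leq1 // big_ord1 coefC. Qed.

Lemma poly_calculusMX p x :
  poly_calculus (p * 'X) T x = poly_calculus p T (T x).
Proof.
rewrite (@poly_calculus_wide (size p).+1); last first.
  by rewrite (leq_trans (size_polyMleq _ _)) // size_polyX addn2.
rewrite big_ord_recl coefMX scale0r add0r; apply: eq_bigr => i _.
by rewrite lift0 coefMX -iterSr.
Qed.

Lemma poly_calculus_linear p : linear (poly_calculus p T).
Proof.
move=> c x y; rewrite /poly_calculus scaler_sumr -big_split; apply: eq_bigr => i _.
have -> : iter i T (c *: x + y) = c *: iter i T x + iter i T y.
  by elim: (i : nat) => //= n ->; rewrite T_linear.
by rewrite scalerDr !scalerA mulrC.
Qed.

Lemma linear_0 S : linear S -> S 0 = 0.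
Proof. by move=> /(_ (-1) 0 0); rewrite scaler0 add0r scaleN1r addNr. Qed.

Lemma poly_calculus0 p : poly_calculus p T 0 = 0.
Proof. exact: linear_0 (poly_calculus_linear p). Qed.

Lemma poly_calculus_scale p c x :
  poly_calculus p T (c *: x) = c *: poly_calculus p T x.
Proof. by have := poly_calculus_linear p c x 0; rewrite poly_calculus0 !addr0. Qed.

Lemma poly_calculusM p q x :
  poly_calculus (p * q) T x = poly_calculus p T (poly_calculus q T x).
Proof.
elim/poly_ind: q x => [|q c IHq] x.
  by rewrite mulr0 -(scale0r (0 : {poly R[i]})) !poly_calculusZ !scale0r poly_calculus0.
rewrite mulrDr mulrA -[p * c%:P]mulrC mul_polyC !poly_calculusD !poly_calculusMX.
rewrite poly_calculusZ poly_calculusC IHq addrC [in RHS]addrC.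
by rewrite poly_calculus_linear.
Qed.

Lemma bounded_operator_comp S1 S2 : bounded_operator S1 -> bounded_operator S2 ->
  bounded_operator (S1 \o S2).
Proof.
move=> [lin1 [M1 b1]] [lin2 [M2 b2]]; split.
  by move=> c x y; rewrite /= lin2 lin1.
(* The absolute value is there because [M1] may be negative when the space is zero. *)
exists (`|M1| * M2) => x /=; apply: le_trans (b1 _) _.
apply: (@le_trans _ _ (`|M1| * rnorm (S2 x))); first by rewrite ler_wpM2r ?ler_norm ?rnorm_ge0.
by rewrite -mulrA ler_wpM2l.
Qed.

Lemma bounded_operator_scale c S : bounded_operator S ->
  bounded_operator (fun x => c *: S x).
Proof.
move=> [lin [M b]]; split.
  by move=> d x y; rewrite lin scalerDr !scalerA mulrC.
exists (complex.Re `|c| * M) => x; rewrite rnormZ -mulrA.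
by rewrite ler_wpM2l ?Re_norm_ge0.
Qed.

Lemma bounded_operator_id : bounded_operator (@id H).
Proof. by split=> //; exists 1 => x; rewrite mul1r. Qed.

Lemma inverse_in_BH_comp S1 S2 S1' S2' :
  inverse_in_BH S1 S1' -> inverse_in_BH S2 S2' ->
  inverse_in_BH (S1 \o S2) (S2' \o S1').
Proof.
move=> [b1 K1 K1'] [b2 K2 K2']; split; first exact: bounded_operator_comp.
- exact: can_comp.
- exact: can_comp.
Qed.

(** Over the complex numbers q splits into linear factors. Each root lies off the spectrum, so each
    factor has a bounded inverse, and these inverses compose. *)
Lemma poly_calculus_invertible q : q != 0 ->
  (forall z, spectrum T z -> ~~ root q z) ->
  exists S, inverse_in_BH (poly_calculus q T) S.
Proof.
have [r -> ] := closed_field_poly_normal q.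
set c := lead_coef q; have [->|c0 _] := eqVneq c 0; first by rewrite scale0r eqxx.
move=> sp.
have {sp}sp z : z \in r -> ~ spectrum T z.
  by move=> zr /sp; rewrite rootZ // root_prod_XsubC zr.
have [S [bS KS KS']] : exists S, inverse_in_BH (poly_calculus (\prod_(z <- r) ('X - z%:P)) T) S.
  elim: r sp => [|z r IHr] sp.
    exists id; rewrite big_nil; split; first exact: bounded_operator_id.
      by move=> x; rewrite poly_calculusC scale1r.
    by move=> x; rewrite poly_calculusC scale1r.
  have [|S invS] := IHr; first by move=> w wr; apply: sp; rewrite inE wr orbT.
  have /contrapT[S' [bS' KS' KS'']] := sp z (mem_head _ _).
  (* The spectrum is defined with z - T while the factor gives T - z, so the inverse acquires a
     factor -1. *)
  have XzE x : poly_calculus ('X - z%:P) T x = - (z *: x - T x).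
    rewrite poly_calculusB poly_calculusC -['X]mul1r poly_calculusMX.
    by rewrite poly_calculusC scale1r opprB.
  have invz : inverse_in_BH (poly_calculus ('X - z%:P) T) (fun x => -1 *: S' x).
    split; first exact: bounded_operator_scale.
    - move=> x; rewrite XzE.
      have := bS'.1 (-1) (z *: x - T x) 0; rewrite scaleN1r addr0 => ->.
      by rewrite (linear_0 bS'.1) KS' addr0 scalerA mulrNN mulr1 scale1r.
    - by move=> x; rewrite poly_calculus_scale XzE KS'' scaleN1r opprK.
  exists (S \o (fun x => -1 *: S' x)).
  have -> : poly_calculus (\prod_(w <- z :: r) ('X - w%:P)) T =
     poly_calculus ('X - z%:P) T \o poly_calculus (\prod_(w <- r) ('X - w%:P)) T.
    by apply/funext => x; rewrite big_cons poly_calculusM.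
  exact: inverse_in_BH_comp.
exists (fun x => c^-1 *: S x); split; first exact: bounded_operator_scale.
- move=> x; rewrite poly_calculusZ.
  rewrite -poly_calculus_scale KS scalerA mulVf // scale1r //.
- by move=> x; rewrite poly_calculusZ poly_calculus_scale KS' scalerA mulfV // scale1r.
Qed.

End FunctionalCalculus.

(** * Modulus inequalities for polynomials on a set and its closure *)

Section PolynomialsOnDomain.
Import Order.TTheory GRing.Theory Num.Theory.

(** The Moebius map preserves the disc, in a form without division: the difference of the squared
    moduli factors as (1 - |a|^2) (|w'|^2 - |w|^2). *)
Lemma moebius_le (C : numClosedFieldType) (a w w' : C) :
  `|a| <= 1 -> `|w| <= `|w'| -> `|w - a * w'| <= `|w' - a^* * w|.
Proof.
move=> a1 ww'; rewrite -ler_sqr ?nnegrE // -subr_ge0 !normCK !rmorphB !rmorphM /=.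
rewrite conjCK.
have -> : (w' - a^* * w) * (w'^* - a * w^*) - (w - a * w') * (w^* - a^* * w'^*)
  = (1 - a * a^*) * (w' * w'^* - w * w^*) by ring.
by rewrite -!normCK mulr_ge0 // subr_ge0 ?ler_sqr ?nnegrE ?exprn_ile1.
Qed.

Lemma continuous_horner (C : numFieldType) (p : {poly C}) :
  continuous (horner p : C -> C).
Proof.
elim/poly_ind: p => [|p c IHp].
  have -> : horner (0 : {poly C}) = cst 0 by apply/funext => z; rewrite horner0.
  exact: cst_continuous.
have -> : horner (p * 'X + c%:P) = (fun z => p.[z] * z) + cst c.
  by apply/funext => z; rewrite hornerMXaddC.
move=> z; apply: (@continuousD C C C); last exact: cst_continuous.
by apply: (@continuousM C C (horner p) id); [exact: IHp|exact: cvg_id].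
Qed.

Lemma horner_le_closure (C : numFieldType) (A : set C^o) (s : C) (p q : {poly C}) :
  s \is Num.real -> (forall z, A z -> `|p.[z]| <= s * `|q.[z]|) ->
  forall z, closure A z -> `|p.[z]| <= s * `|q.[z]|.
Proof.
move=> s_real pq z clz.
pose g (w : C) : C := s * `|q.[w]| - `|p.[w]|.
(* The order on [C] is partial; realness of g allows arguing from g z < 0, which would persist near
   z and so at a point of [A]. *)
have g_real w : g w \is Num.real by rewrite realB ?normr_real // realM ?normr_real.
have norm_cont (r : {poly C}) : {for z : C, continuous (fun w : C => `|r.[w]|)}.
  by apply: continuous_comp; [exact: continuous_horner|exact: norm_continuous].
have cg : g w @[w --> (z : C)] --> g z.
  apply: (@continuousB C C C _ _ z); last exact: norm_cont.
  by apply: (@continuousM C C (cst s)); [exact: cst_continuous|exact: norm_cont].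
rewrite -subr_ge0 -/(g z) real_leNgt //; apply/negP => gz.
have gz' : 0 < - g z by rewrite oppr_gt0.
have g_near : \forall w \near (z : C), `|g z - g w| < - g z.
  by move/cvgrPdist_lt: cg => /(_ _ gz').
have [w [/pq]] := clz _ g_near.
rewrite -subr_ge0 -/(g w) /= => gw.
rewrite distrC ger0_norm ?subr_ge0 ?(le_trans (ltW gz)) //.
by rewrite ltrBlDr addNr => /(le_lt_trans gw); rewrite ltxx.
Qed.

End PolynomialsOnDomain.

(** * Bounds on rational functions of the operator, freed of inverses *)

Section RationalCalculus.
Import Order.TTheory GRing.Theory Num.Theory.
Variables (R : realType) (H : completeNormedModType R[i]).
Variables (dot : {dot H for Num.conj}).
Hypothesis norm_dot : forall x : H, `|x| ^+ 2 = dot x x.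
Variables (T : H -> H) (Omega : set R[i]^o).
Hypothesis T_linear : linear T.
Hypothesis Omega_neq0 : Omega !=set0.
Hypothesis spectrum_sub : spectrum T `<=` closure Omega.
Implicit Types (p q : {poly R[i]}) (x v : H) (a z : R[i]) (c s K : R).

(** The junk value of [operator_inv] is ruled out: q is nonzero because [Omega] has a point, and q
    has no root on the spectrum. *)
Lemma operator_inv_inverse q : no_zero_on_closure Omega q ->
  inverse_in_BH (poly_calculus q T) (operator_inv (poly_calculus q T)).
Proof.
move=> q0; apply: xgetPex; apply: poly_calculus_invertible => //.
  case: Omega_neq0 => z Oz; apply/eqP => qE.
  by have := q0 z (subset_closure Oz); rewrite qE horner0 eqxx.
by move=> z /spectrum_sub /q0.
Qed.

(** Substituting x = q(T) v removes the inverse, so later estimates compare only p(T) v and q(T)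
    v. *)
Lemma rational_calculusE p q v : no_zero_on_closure Omega q ->
  rational_calculus p q T (poly_calculus q T v) = poly_calculus p T v.
Proof. by move=> /operator_inv_inverse[_ qK _]; rewrite /rational_calculus /= qK. Qed.

Lemma norm_on_le1 p q : no_zero_on_closure Omega q ->
  (forall z, Omega z -> `|p.[z]| <= `|q.[z]|) ->
  (norm_on Omega (rational_fun p q) <= 1%:E)%E.
Proof.
move=> q0 pq; apply/ereal_supP => _ [z Oz <-]; rewrite lee_fin -lecR Re_normE.
have qz : 0 < `|q.[z]| by rewrite normr_gt0 q0 //; exact: subset_closure.
by rewrite normf_div ler_pdivrMr // mul1r pq.
Qed.

Lemma poly_calculus_eq0 q v : no_zero_on_closure Omega q ->
  poly_calculus q T v = 0 -> v = 0.
Proof.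
move=> /operator_inv_inverse[_ qK _] qv0.
by have := qK 0; rewrite (poly_calculus0 T_linear) => <-; rewrite -qv0 qK.
Qed.

Lemma poly_calculus_normalize q v : no_zero_on_closure Omega q -> v != 0 ->
  exists2 t : R, 0 < t & rnorm (poly_calculus q T (t%:C *: v)) = 1
    /\ rnorm (poly_calculus q T v) = t^-1.
Proof.
move=> q0 v0; set w := poly_calculus q T v.
have w0 : 0 < rnorm w.
  rewrite lt_neqAle rnorm_ge0 eq_sym rnorm_eq0 andbT.
  by apply: contraNneq v0 => /(poly_calculus_eq0 q0)->.
exists (rnorm w)^-1; first by rewrite invr_gt0.
rewrite invrK (poly_calculus_scale T_linear) rnormZ; split=> //.
by rewrite Re_norm_realC ?invr_ge0 ?ltW // mulVf // gt_eqF.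
Qed.

(** This is the bound on f(T) at x = q(T) v, with v rescaled so that x is a unit vector; v = 0 is
    treated apart. *)
Lemma spectral_set_bound K p q v : 0 <= K -> spectral_set K Omega T ->
  no_zero_on_closure Omega q -> (forall z, Omega z -> `|p.[z]| <= `|q.[z]|) ->
  rnorm (poly_calculus p T v) <= K * rnorm (poly_calculus q T v).
Proof.
move=> K0 sK q0 pq; have [->|v0] := eqVneq v 0.
  rewrite !(poly_calculus0 T_linear).
  by have /eqP -> : rnorm (0 : H) == 0; rewrite ?rnorm_eq0 // mulr0.
have [t t0 [t1 ->]] := poly_calculus_normalize q0 v0.
have : (operator_norm (rational_calculus p q T) <= K%:E)%E.
  apply: le_trans (sK p q q0) _.
  by rewrite -[leRHS]mule1 lee_wpmul2l ?lee_fin // norm_on_le1.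
move=> /ereal_supP/(_ (rnorm (poly_calculus p T (t%:C *: v)))%:E).
rewrite lee_fin (poly_calculus_scale T_linear) rnormZ (Re_norm_realC (ltW t0)).
rewrite mulrC -ler_pdivlMr //; apply.
exists (poly_calculus q T (t%:C *: v)); first by rewrite /= t1.
rewrite rational_calculusE // (poly_calculus_scale T_linear) rnormZ.
by rewrite (Re_norm_realC (ltW t0)) mulrC.
Qed.

Lemma numerical_radius_set_bound c p q v : 0 <= c ->
  numerical_radius_set dot c Omega T ->
  no_zero_on_closure Omega q -> (forall z, Omega z -> `|p.[z]| <= `|q.[z]|) ->
  complex.Re `|dot (poly_calculus p T v) (poly_calculus q T v)|
    <= c * rnorm (poly_calculus q T v) ^+ 2.
Proof.
move=> c0 nc q0 pq; have [->|v0] := eqVneq v 0.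
  rewrite !(poly_calculus0 T_linear).
  by rewrite linear0l normr0 mulr_ge0 ?sqr_ge0.
have [t t0 [t1 ->]] := poly_calculus_normalize q0 v0.
have : (numerical_radius dot (rational_calculus p q T) <= c%:E)%E.
  apply: le_trans (nc p q q0) _.
  by rewrite -[leRHS]mule1 lee_wpmul2l ?lee_fin // norm_on_le1.
set d := dot _ _.
move=> /ereal_supP/(_ (t ^+ 2 * complex.Re `|d|)%:E).
rewrite lee_fin exprVn mulrC -ler_pdivlMr ?exprn_gt0 //; apply.
exists (poly_calculus q T (t%:C *: v)); first by rewrite /= t1.
rewrite rational_calculusE // !(poly_calculus_scale T_linear).
have tC : `|t%:C| = t%:C by rewrite gtr0_norm ?ltcR.
by rewrite dotZ conj_realC -/d !normrM tC -[`|d|]Re_normE !realCM /= mulrA mulrC -expr2.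
Qed.

(** * Moebius transforms of a rational function *)

(** The bound |p| <= s |q| extends to the closure by continuity, so a zero there would give s |q| =
    |a| |p| <= |a| s |q| < s |q|. *)
Lemma moebius_no_zero p q s a : 0 < s -> `|a| < 1 ->
  no_zero_on_closure Omega q -> (forall z, Omega z -> `|p.[z]| <= s%:C * `|q.[z]|) ->
  no_zero_on_closure Omega (s%:C *: q - a^* *: p).
Proof.
move=> s0 a1 q0 pq z clz; rewrite hornerD hornerN !hornerZ subr_eq0.
apply/eqP => /(congr1 Num.norm); rewrite !normrM norm_conjC.
have sC : 0 < s%:C by rewrite ltcR.
rewrite (gtr0_norm sC) => sq.
have qz : 0 < s%:C * `|q.[z]| by rewrite mulr_gt0 // normr_gt0 q0.
have pz : `|p.[z]| <= s%:C * `|q.[z]|.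
  by apply: (horner_le_closure _ pq clz); apply: gtr0_real.
have : s%:C * `|q.[z]| < s%:C * `|q.[z]|.
  rewrite {1}sq (le_lt_trans (ler_wpM2l _ pz)) //.
  by rewrite -[ltRHS]mul1r ltr_pM2r.
by rewrite ltxx.
Qed.

(** The two polynomials are numerator and denominator of phi_a(f / s) with f = p / q. *)
Lemma moebius_le_on p q s a : 0 < s -> `|a| < 1 ->
  (forall z, Omega z -> `|p.[z]| <= s%:C * `|q.[z]|) ->
  forall z, Omega z ->
    `|(p - (a * s%:C) *: q).[z]| <= `|(s%:C *: q - a^* *: p).[z]|.
Proof.
move=> s0 a1 pq z Oz; rewrite !hornerD !hornerN !hornerZ -mulrA.
apply: moebius_le; first exact: ltW.
by rewrite normrM (@gtr0_norm _ s%:C) ?ltcR // pq.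
Qed.

Lemma norm_on_ge0 f : (0 <= norm_on Omega f)%E.
Proof.
have [z Oz] := Omega_neq0.
by apply: ereal_sup_ge; exists (complex.Re `|f z|)%:E; [exists z|rewrite lee_fin Re_norm_ge0].
Qed.

(** Replaces the supremum, possibly infinite or zero, by an arbitrary positive real bound s of |p /
    q|, by which f can then be divided. *)
Lemma le_mul_norm_on c p q (m : \bar R) : 0 < c -> no_zero_on_closure Omega q ->
  (forall s, 0 < s -> (forall z, Omega z -> `|p.[z]| <= s%:C * `|q.[z]|) ->
     (m <= (c * s)%:E)%E) ->
  (m <= c%:E * norm_on Omega (rational_fun p q))%E.
Proof.
move=> c0 q0 bound; have := norm_on_ge0 (rational_fun p q).
case E : (norm_on _ _) => [r| |//]; last by rewrite gt0_muley ?lte_fin ?leey.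
rewrite lee_fin => r0; apply/lee_addgt0Pr => e e0.
(* The bound s = r + e / c is positive even if r = 0, and costs exactly e after multiplication by
   c. *)
have -> : (c%:E * r%:E + e%:E)%E = (c * (r + e / c))%:E.
  by rewrite -EFinM -EFinD mulrDr mulrCA divff ?gt_eqF // mulr1.
apply: bound; first by rewrite ltr_wpDl // divr_gt0.
move=> z Oz; have qz : 0 < `|q.[z]| by rewrite normr_gt0 q0 //; exact: subset_closure.
rewrite -ler_pdivrMr // -normf_div -Re_normE lecR.
apply: (@le_trans _ _ r); last by rewrite lerDl divr_ge0 ?ltW.
by rewrite -lee_fin -E; apply: ereal_sup_ubound; exists z.
Qed.

(** * The two implications *)

Lemma spectral_to_numerical K : 1 <= K -> spectral_set K Omega T ->
  numerical_radius_set dot (2^-1 * (K + K^-1)) Omega T.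
Proof.
move=> K1 sK p q q0; have K0 : 0 < K by exact: lt_le_trans K1.
apply: le_mul_norm_on => //; first by rewrite mulr_gt0 ?addr_gt0 ?invr_gt0.
move=> s s0 pq; apply/ereal_supP => _ [x /= x1 <-]; rewrite lee_fin.
have [_ _ /(_ x) qv] := operator_inv_inverse q0.
set v := operator_inv _ x in qv; rewrite /rational_calculus /= -/v.
set y := poly_calculus p T v.
(* Dividing f by s is done by scaling x instead: the pair is (s x, y), where x = q(T) v and y = p(T)
   v. *)
have := @moebius_norm_bound _ _ _ norm_dot K (s%:C *: x) y K1.
have sC : `|s%:C| = s%:C by rewrite ger0_norm ?ler0c ?ltW.
rewrite -[y]scale1r dotZ conj_realC mul1r !scale1r normrM sC -Re_normE realCM.
rewrite rnormZ (Re_norm_realC (ltW s0)) x1 mulr1 /= => bound.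
(* The scaled pair bounds s |<y, x>| by a multiple of s^2, so the goal is first multiplied by s. *)
rewrite -(ler_pM2l s0) mulrCA -expr2; apply: bound => a.
rewrite -ltcR Re_normE => a1.
have := spectral_set_bound v (ltW K0) sK (moebius_no_zero s0 a1 q0 pq) (moebius_le_on s0 a1 pq).
by rewrite !(poly_calculusB, poly_calculusZ) qv -scalerA.
Qed.

Lemma numerical_to_spectral K : 1 <= K ->
  numerical_radius_set dot (2^-1 * (K + K^-1)) Omega T -> spectral_set K Omega T.
Proof.
move=> K1 nK p q q0; have K0 : 0 < K by exact: lt_le_trans K1.
apply: le_mul_norm_on => //.
move=> s s0 pq; apply/ereal_supP => _ [x /= x1 <-]; rewrite lee_fin.
have [_ _ /(_ x) qv] := operator_inv_inverse q0.
set v := operator_inv _ x in qv; rewrite /rational_calculus /= -/v.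
set y := poly_calculus p T v.
(* The operator norm is a supremum over the closed unit ball, so only |s x| <= s holds here. *)
apply: (@le_trans _ _ (K * rnorm (s%:C *: x))); last first.
  by rewrite rnormZ (Re_norm_realC (ltW s0)) mulrA ler_piMr // mulr_ge0 ?ltW.
apply: (@moebius_numerical_bound _ _ _ norm_dot) => // a.
rewrite -ltcR Re_normE => a1.
have c0 : 0 <= 2^-1 * (K + K^-1) by rewrite mulr_ge0 ?addr_ge0 ?invr_ge0 ?(ltW K0).
have := numerical_radius_set_bound v c0 nK (moebius_no_zero s0 a1 q0 pq) (moebius_le_on s0 a1 pq).
by rewrite !(poly_calculusB, poly_calculusZ) qv -scalerA.
Qed.

End RationalCalculus.

Theorem theorem2p1 (R : realType) (H : completeNormedModType R[i])
    (dot : {dot H for Num.conj}) (norm_dot : forall x : H, `|x| ^+ 2 = dot x x)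
    (T : H -> H) (T_bounded : bounded_operator T)
    (Omega : set R[i]^o) (Omega_open : open Omega)
    (Omega_connected : connected Omega) (Omega_neq0 : Omega !=set0)
    (spectrum_sub : spectrum T `<=` closure Omega)
    (K : R) (K_ge1 : 1 <= K) :
  spectral_set K Omega T <->
  numerical_radius_set dot (2^-1 * (K + K^-1)) Omega T.
Proof.
have [T_linear _] := T_bounded.
by split; [apply: spectral_to_numerical|apply: numerical_to_spectral].
Qed.
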